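(* Let $\delta\in(0,1/2)$ and let $A,B\in\mathbb{R}^{d\times d}$ be symmetric positive definite matrices whose eigenvalues all lie in $[\delta,1-\delta]$. Let $n\ge 0$ and $m\ge1$ be integers, and let $p_n$ be the degree-$n$ Chebyshev interpolant of $\log x$ on $[\delta,1-\delta]$: $$p_n(x)=\sum_{k=0}^n c_k\,T_k\!\left(\frac{2}{1-2\delta}x-\frac{1}{1-2\delta}\right),\qquad c_k=\frac{2-[k=0]}{n+1}\sum_{j=0}^n \log\!\left(\frac{1-2\delta}{2}x_j+\frac12\right)T_k(x_j),$$ where $x_j=\cos\left(\frac{\pi(j+1/2)}{n+1}\right)$ for $j=0,\dots,n$, $[k=0]$ equals $1$ if $k=0$ and $0$ otherwise, and $T_k$ are the Chebyshev polynomials ($T_0=1$, $T_1(x)=x$, $T_{k+1}(x)=2xT_k(x)-T_{k-1}(x)$). Let $\mathbf{v}^{(1)},\dots,\mathbf{v}^{(m)}$ be independent random vectors in $\{-1,+1\}^d$ with i.i.d. uniformly distributed entries, and define (using the same vectors for both matrices) $$\Gamma_A=\frac1m\sum_{t=1}^m\mathbf{v}^{(t)\top}p_n(A)\mathbf{v}^{(t)},\qquad \Gamma_B=\frac1m\sum_{t=1}^m\mathbf{v}^{(t)\top}p_n(B)\mathbf{v}^{(t)}.$$ Then $$\mathbf{Var}\left[\Gamma_A-\Gamma_B\right]\le\frac{32M^2\rho^2(\rho+1)^2}{m(\rho-1)^6(1-2\delta)^2}\,\|A-B\|_F^2,$$ where $M=5\log(2/\delta)$ and $\rho=1+\frac{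2}{\sqrt{2/\delta-1}-1}$.
   Context: For a symmetric matrix $A$ and polynomial $q$, $q(A)$ denotes the matrix polynomial. $\|\cdot\|_F$ is the Frobenius norm. $\Gamma_A$ is exactly the output of the log-determinant approximation scheme (LDAS: Chebyshev expansion of degree $n$ combined with the Hutchinson trace estimator with $m$ Rademacher vectors) applied to $A$. *)

(* Defs.v *)
From HB Require Import structures.
From mathcomp Require Import all_boot all_order all_algebra.
From mathcomp Require Import all_classical all_reals all_analysis.

Set Implicit Arguments.
Unset Strict Implicit.
Unset Printing Implicit Defensive.

Import Order.TTheory GRing.Theory Num.Theory.
Import numFieldNormedType.Exports.

Local Open Scope classical_set_scope.
Local Open Scope ring_scope.

Section Matrices.
Context {R : realType} {d : nat}.

Definition positive_definite (A : 'M[R]_d) : Prop :=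
  forall x : 'cV[R]_d, x != 0 -> 0 < (x^T *m A *m x) 0 0.

Definition spectrum_in (A : 'M[R]_d) (a b : R) : Prop :=
  forall l : R, eigenvalue A l -> a <= l <= b.

Definition frobenius (A : 'M[R]_d) : R :=
  Num.sqrt (\sum_i \sum_j A i j ^+ 2).

End Matrices.

Section Chebyshev.
Context {R : realType}.

Fixpoint chebyshev (k : nat) : {poly R} :=
  match k with
  | 0 => 1
  | 1 => 'X
  | (k''.+1 as k').+1 => 2 *: ('X * chebyshev k') - chebyshev k''
  end.

Definition cheb_node (n j : nat) : R :=
  cos (pi * (j%:R + 1 / 2) / n.+1%:R).

Definition cheb_coef (delta : R) (n k : nat) : R :=
  (2 - (k == 0%N)%:R) / n.+1%:R *
  \sum_(j < n.+1)
    ln ((1 - 2 * delta) / 2 * cheb_node n j + 1 / 2) *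
    (chebyshev k).[cheb_node n j].

Definition cheb_log (delta : R) (n : nat) : {poly R} :=
  \sum_(k < n.+1) cheb_coef delta n k *:
    (chebyshev k \Po
       ((2 / (1 - 2 * delta)) *: 'X - (1 / (1 - 2 * delta))%:P)).

End Chebyshev.

Section Probability.
Context {dT : measure_display} {T : measurableType dT} {R : realType}.

Definition mutually_independent {dU : measure_display} {U : measurableType dU}
    (P : probability T R) (I : finType) (X : I -> T -> U) : Prop :=
  forall (J : {set I}) (B : I -> set U),
    (forall i, measurable (B i)) ->
    P (\bigcap_(i in [set` J]) (X i @^-1` B i)) =
    (\prod_(i in J) P (X i @^-1` B i))%E.

Definition rademacher_vector (P : probability T R) (d : nat)
    (v : T -> d.-tuple R) : Prop :=
  [/\ forall w i, tnth (v w) i = 1 \/ tnth (v w) i = -1,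
      forall i, P [set w | tnth (v w) i = 1] = (1 / 2)%:E,
      forall i, P [set w | tnth (v w) i = -1] = (1 / 2)%:E
    & mutually_independent P (fun i w => tnth (v w) i)].

(* The matrix polynomial [horner_mx] only exists in positive dimension, hence
   [d.+1]. *)
Definition ldas (delta : R) (n m d : nat) (v : 'I_m -> T -> d.+1.-tuple R)
    (A : 'M[R]_d.+1) (w : T) : R :=
  m%:R^-1 * \sum_(t < m)
    (let x := \col_i tnth (v t w) i in
     (x^T *m horner_mx A (cheb_log delta n) *m x) 0 0).

End Probability.

(* Main.v *)
(** The estimators depend on the random vectors only through the uniform sign
    pattern, and the products [v_i v_j] ([i < j]) are orthonormal, so the variance
    is at most [2 / m] times the squared Frobenius norm of [p(A) - p(B)].  In
    eigenbases of [A] and [B] the entries of this difference are divided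
    differences of [p] times those of [A - B], so a Lipschitz constant of [p] on
    [[delta, 1 - delta]] is a Lipschitz constant for the Frobenius norm.

    For the Lipschitz constant, [T_k] is [k^2]-Lipschitz on [[-1, 1]], and the
    coefficients satisfy [|c_k| <= 2 r^k] with [r + 1/r = 2 / (1 - 2 delta)]: up to
    an additive constant the interpolated function is [ln (1 + 2 r x + r^2)], whose
    derivative in [r] is, up to a constant, a Poisson kernel, and the discrete
    cosine coefficients of the Poisson kernel at the Chebyshev nodes are explicit.
    This is stronger than needed by the factor [M >= 1], as [r <= 1 / rho]. *)

Require Import Defs.
From HB Require Import structures.
From mathcomp Require Import all_boot all_order all_algebra.
From mathcomp Require Import all_classical all_reals all_analysis.
From mathcomp Require Import complex ring lra zify.

Set Implicit Arguments.
Unset Strict Implicit.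
Unset Printing Implicit Defensive.

Import Order.TTheory GRing.Theory Num.Theory.
Import numFieldNormedType.Exports.

Local Open Scope classical_set_scope.
Local Open Scope ring_scope.

(** * Chebyshev polynomials and cosine sums over the Chebyshev nodes *)

Lemma chebyshev_cos (R : realType) k (t : R) :
  (Defs.chebyshev k).[cos t] = cos (k%:R * t).
Proof.
suff: (Defs.chebyshev k).[cos t] = cos (k%:R * t) /\
      (Defs.chebyshev k.+1).[cos t] = cos (k.+1%:R * t) by case.
elim: k => [|k [IH1 IH2]].
  by rewrite /= hornerC hornerX mul0r cos0 mul1r.
split=> //.
have -> : Defs.chebyshev k.+2 =
    2 *: ('X * Defs.chebyshev k.+1) - Defs.chebyshev k :> {poly R}.
  by [].
rewrite hornerD hornerN hornerZ hornerM hornerX IH1 IH2.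
have -> : k.+2%:R * t = k.+1%:R * t + t by rewrite -natr1; ring.
have -> : k%:R * t = k.+1%:R * t - t by rewrite -natr1; ring.
by rewrite cosB cosD; ring.
Qed.

Lemma sin_nat_pi (R : realType) k : sin (k%:R * pi) = 0 :> R.
Proof.
elim: k => [|k IH]; first by rewrite mul0r sin0.
by rewrite -natr1 mulrDl mul1r sinDpi IH oppr0.
Qed.

(** The cosine of this angle is [cheb_node n j]. *)
Definition cheb_angle (R : realType) (n j : nat) : R :=
  pi * (j%:R + 1 / 2) / n.+1%:R.

(** With [a] half the angular step, multiplying by [2 * sin a] makes the sum telescope to
    [sin (k * pi) - sin 0]. The range of [k] puts [a] strictly between 0 and [pi], so [sin a] can be
    cancelled. *)
Lemma sum_cos_cheb_angle (R : realType) n k : (0 < k < 2 * n.+1)%N ->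
  \sum_(j < n.+1) cos (k%:R * cheb_angle R n j) = 0.
Proof.
move=> /andP[k_gt0 k_lt].
have N0 : n.+1%:R != 0 :> R by rewrite pnatr_eq0.
pose a : R := k%:R * pi / (2 * n.+1%:R).
have sa : 0 < sin a.
  apply: sin_gt0_pi; rewrite /a divr_gt0 ?mulr_gt0 ?pi_gt0 ?ltr0n//=.
  rewrite ltr_pdivrMr ?mulr_gt0 ?ltr0n// [ltRHS]mulrC ltr_pM2r ?pi_gt0//.
  by rewrite -natrM ltr_nat.
apply: (@mulfI _ (2 * sin a)); first by rewrite mulf_neq0 ?pnatr_eq0// gt_eqF.
rewrite mulr0 mulr_sumr.
under eq_bigr => j _.
  have -> : 2 * sin a * cos (k%:R * cheb_angle R n j) =
    sin (j.+1%:R * (2 * a)) - sin (j%:R * (2 * a)).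
    have -> : k%:R * cheb_angle R n j = j%:R * (2 * a) + a.
      by rewrite /cheb_angle /a; field.
    have -> : j.+1%:R * (2 * a) = (j%:R * (2 * a) + a) + a by rewrite -natr1; ring.
    move: (j%:R * _) => u; rewrite -[X in _ - sin X](addrK a u).
    by rewrite sinB (sinD (u + a)); ring.
  over.
rewrite -(big_mkord xpredT (fun j => sin (j.+1%:R * (2 * a)) - sin (j%:R * (2 * a)))).
rewrite (telescope_sumr (fun j => sin (j%:R * (2 * a))))//.
have -> : n.+1%:R * (2 * a) = k%:R * pi by rewrite /a; field.
by rewrite sin_nat_pi mul0r sin0 subrr.
Qed.

Lemma cheb_angle_orthogonal (R : realType) n k l : (0 < k <= n)%N -> (l <= n)%N ->
  \sum_(j < n.+1) cos (l%:R * cheb_angle R n j) * cos (k%:R * cheb_angle R n j) =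
    (l == k)%:R * (n.+1%:R / 2).
Proof.
move=> /andP[k0 kn] ln.
(* With truncated subtraction, [(l - k) + (k - l)] is the natural number |l - k|. Both frequencies
   stay below [2 * n.+1], so only l = k leaves a nonzero sum, at frequency 0. *)
have E j : cos (l%:R * cheb_angle R n j) * cos (k%:R * cheb_angle R n j) =
   2^-1 * cos ((l + k)%:R * cheb_angle R n j) +
   2^-1 * cos (((l - k) + (k - l))%:R * cheb_angle R n j).
  rewrite natrD mulrDl cosD.
  have [lk|/ltnW lk] := leqP l k.
    have -> : (l - k + (k - l))%:R = k%:R - l%:R :> R.
      by rewrite (eqP lk) add0n natrB.
    by rewrite mulrBl cosB; field.
  have -> : (l - k + (k - l))%:R = l%:R - k%:R :> R.
    by rewrite (eqP lk) addn0 natrB.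
  by rewrite mulrBl cosB; field.
under eq_bigr do rewrite E.
rewrite big_split/= -!mulr_sumr sum_cos_cheb_angle; last lia.
have [->|lk] := eqVneq l k.
  rewrite subnn addn0 mul1r mulr0 add0r.
  under eq_bigr do rewrite mul0r cos0.
  by rewrite sumr_const card_ord mulrC.
by rewrite sum_cos_cheb_angle ?mul0r ?mulr0 ?addr0//; lia.
Qed.

(** The nodes are the zeros of the Chebyshev polynomial of degree [n.+1]. *)
Lemma cos_nat_cheb_angle (R : realType) n j : cos (n.+1%:R * cheb_angle R n j) = 0.
Proof.
have -> : n.+1%:R * cheb_angle R n j = j%:R * pi + pi / 2.
  by rewrite /cheb_angle; field.
by rewrite cosDpihalf sin_nat_pi oppr0.
Qed.

(** * The Poisson kernel at the Chebyshev nodes *)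

Lemma poisson_denominator_gt0 (R : realType) (r c : R) :
  0 <= r < 1 -> -1 <= c -> 0 < 1 + 2 * r * c + r ^+ 2.
Proof.
move=> /andP[r0 r1] c1.
have -> : 1 + 2 * r * c + r ^+ 2 = (1 - r) ^+ 2 + 2 * r * (c - -1) by ring.
by rewrite ltr_pwDl ?exprn_gt0 ?subr_gt0// !mulr_ge0// subr_ge0.
Qed.

Section DiscretePoisson.
Context {R : realType} (n : nat) (r : R) (r_gt0 : 0 < r).

(* Sampling at [n.+1] Chebyshev nodes folds frequency [2 * n.+1 - k] onto [k] with
   a sign change. *)
Definition alias_weight (k : nat) : R := r ^+ k - r ^+ (2 * n.+1) / r ^+ k.

(** Both [r ^+ k] and its inverse solve (1 + r^2) w_k = r (w_{k-1} + w_{k+1}), hence so does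
    [alias_weight]. After multiplication by the denominator all intermediate frequencies cancel;
    only the constant and two boundary terms at [K] survive. *)
Lemma poisson_partial_sum t K :
  (1 + 2 * r * cos t + r ^+ 2) *
    (alias_weight 0 +
     2 * \sum_(1 <= k < K.+1) (-1) ^+ k * alias_weight k * cos (k%:R * t)) =
  (1 - r ^+ 2) * (1 + r ^+ (2 * n.+1)) +
  (-1) ^+ K * 2 * r *
    (alias_weight K.+1 * cos (K%:R * t) + alias_weight K * cos (K.+1%:R * t)).
Proof.
have r0 : r != 0 by rewrite gt_eqF.
elim: K => [|K IH].
  rewrite big_geq// mul0r cos0 mul1r /alias_weight !expr0 expr1.
  by rewrite (mul1r t); set q := r ^+ (2 * _); field.
rewrite big_nat_recr//= (mulrDr 2) addrA (mulrDr (1 + _ + _)) IH.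
have -> : cos (K.+2%:R * t) = 2 * cos t * cos (K.+1%:R * t) - cos (K%:R * t).
  have -> : K.+2%:R * t = K.+1%:R * t + t by rewrite -natr1; ring.
  have -> : K%:R * t = K.+1%:R * t - t by rewrite -natr1; ring.
  by rewrite cosB cosD; ring.
have rK : r ^+ K != 0 by rewrite expf_neq0.
rewrite /alias_weight; move: (r ^+ (2 * n.+1)) => q.
rewrite (exprS _ K.+1) !(exprS _ K); move: (r ^+ K) rK => u u0.
by move: ((-1) ^+ K) (cos _) (cos _) (cos _) => ????; field; rewrite r0 u0.
Qed.

(** For [K = n] both boundary terms vanish: one because the nodes are zeros of T_{n+1}, the other
    because [alias_weight n.+1 = 0]. *)
Lemma poisson_cheb_angle j : r < 1 ->
  (1 - r ^+ 2) / (1 + 2 * r * cos (cheb_angle R n j) + r ^+ 2) =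
  (alias_weight 0 + 2 * \sum_(1 <= k < n.+1)
     (-1) ^+ k * alias_weight k * cos (k%:R * cheb_angle R n j)) /
  (1 + r ^+ (2 * n.+1)).
Proof.
move=> r1.
have D0 : 0 < 1 + 2 * r * cos (cheb_angle R n j) + r ^+ 2.
  by apply: poisson_denominator_gt0; rewrite ?cos_geN1 ?r1 ?ltW.
have D1 : 0 < 1 + r ^+ (2 * n.+1) by rewrite ltr_pwDl// exprn_ge0// ltW.
apply/eqP; rewrite eqr_div ?lt0r_neq0//; apply/eqP.
rewrite [RHS]mulrC poisson_partial_sum cos_nat_cheb_angle mulr0 addr0.
rewrite /alias_weight.
rewrite (_ : (2 * n.+1 = n.+1 + n.+1)%N); last by rewrite mul2n addnn.
by rewrite exprD mulfK ?expf_neq0 ?gt_eqF// subrr mul0r mulr0 addr0.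
Qed.

Lemma sum_poisson_cheb_angle k : r < 1 -> (0 < k <= n)%N ->
  \sum_(j < n.+1) (1 - r ^+ 2) /
      (1 + 2 * r * cos (cheb_angle R n j) + r ^+ 2) *
      cos (k%:R * cheb_angle R n j) =
  n.+1%:R * (-1) ^+ k * alias_weight k / (1 + r ^+ (2 * n.+1)).
Proof.
move=> r1 kn; have /andP[k0 kn'] := kn.
under eq_bigr do rewrite poisson_cheb_angle//.
under eq_bigr do rewrite mulrAC mulrDl.
rewrite -mulr_suml big_split/= -mulr_sumr sum_cos_cheb_angle; last lia.
rewrite mulr0 add0r; congr (_ / _).
under eq_bigr do rewrite -mulrA mulr_suml.
rewrite -mulr_sumr exchange_big/=.
have E i : (1 <= i < n.+1)%N ->
  \sum_(j < n.+1) (-1) ^+ i * alias_weight i * cos (i%:R * cheb_angle R n j) *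
     cos (k%:R * cheb_angle R n j) =
  (-1) ^+ i * alias_weight i * ((i == k)%:R * (n.+1%:R / 2)).
  move=> /andP[_ i_n]; under eq_bigr do rewrite -mulrA.
  by rewrite -mulr_sumr cheb_angle_orthogonal.
rewrite (eq_big_nat _ _ E) (bigD1_seq k)/= ?iota_uniq//; last first.
  by rewrite mem_index_iota; lia.
rewrite eqxx (mul1r (n.+1%:R / 2)) big1 ?addr0; first by field.
by move=> i /negbTE ->; rewrite mul0r mulr0.
Qed.

(** The weight equals r^k - r^(2(n+1)-k), which lies between 0 and r^k, and the denominator is at
    least 1. *)
Lemma alias_weight_bound k : r < 1 -> (k <= n)%N ->
  `|alias_weight k / (1 + r ^+ (2 * n.+1))| <= r ^+ k.
Proof.
move=> r1 kn.
have E : r ^+ (2 * n.+1) / r ^+ k = r ^+ (2 * n.+1 - k).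
  by rewrite -expfB//; lia.
have le : r ^+ (2 * n.+1 - k) <= r ^+ k.
  by rewrite ler_wiXn2l ?ltW//; lia.
have D1 : 1 <= 1 + r ^+ (2 * n.+1) by rewrite lerDl exprn_ge0// ltW.
rewrite /alias_weight E normrM ger0_norm ?subr_ge0// ger0_norm; last first.
  by rewrite invr_ge0 (le_trans ler01).
rewrite ler_pdivrMr ?(lt_le_trans ltr01)//.
apply: (@le_trans _ _ (r ^+ k)); first by rewrite gerBl exprn_ge0// ltW.
by rewrite ler_peMr// exprn_ge0// ltW.
Qed.

End DiscretePoisson.

(** * Discrete cosine coefficients of the logarithm *)

Lemma is_derive_poisson_log (R : realType) (c x : R) : 0 <= x < 1 -> -1 <= c ->
  is_derive x 1 (fun s => ln (1 + 2 * s * c + s ^+ 2))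
    ((2 * c + 2 * x) / (1 + 2 * x * c + x ^+ 2)).
Proof.
move=> x01 c1.
pose q : {poly R} := 1 + (2 * c) *: 'X + 'X ^+ 2.
have qE s : q.[s] = 1 + 2 * s * c + s ^+ 2.
  by rewrite /q !hornerE; ring.
have -> : (fun s => ln (1 + 2 * s * c + s ^+ 2)) = @ln R \o horner q.
  by apply/funext => s /=; rewrite qE.
have q0 : 0 < q.[x] by rewrite qE poisson_denominator_gt0.
have -> : (2 * c + 2 * x) / (1 + 2 * x * c + x ^+ 2) = q.[x]^-1 * q^`().[x].
  rewrite qE mulrC; congr (_ * _).
  by rewrite /q !derivD derivZ derivC derivX derivXn !hornerE /=; ring.
exact: (is_derive1_comp (is_derive1_ln q0) (is_derive_poly q x)).
Qed.

(* Differentiating in the parameter turns the logarithm into a discrete Poisson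
   kernel, whose Chebyshev coefficients are explicit. *)
Lemma sum_log_cheb_angle_bound (R : realType) n k (r : R) :
  0 < r < 1 -> (0 < k <= n)%N ->
  `|\sum_(j < n.+1) ln (1 + 2 * r * cos (cheb_angle R n j) + r ^+ 2) *
      cos (k%:R * cheb_angle R n j)| <= n.+1%:R * r ^+ k.
Proof.
move=> /andP[r0 r1] kn; have /andP[k0 kn'] := kn.
pose c (j : 'I_n.+1) : R := cos (cheb_angle R n j).
pose w (j : 'I_n.+1) : R := cos (k%:R * cheb_angle R n j).
pose h (j : 'I_n.+1) (s : R) : R := w j *: ln (1 + 2 * s * c j + s ^+ 2).
pose dh (j : 'I_n.+1) (s : R) : R :=
  w j *: ((2 * c j + 2 * s) / (1 + 2 * s * c j + s ^+ 2)).
have hE s : (\sum_j h j) s = \sum_(j < n.+1) ln (1 + 2 * s * c j + s ^+ 2) * w j.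
  by rewrite fct_sumE; apply: eq_bigr => j _; rewrite /h [LHS]mulrC.
have der (s : R) : 0 <= s < 1 -> is_derive s 1 (\sum_j h j) (\sum_j dh j s).
  move=> s01; apply: is_derive_sum => j; apply: is_deriveZ.
  by apply: is_derive_poisson_log => //; exact: cos_geN1.
(* The mean value theorem is applied between 0 and [r]; at parameter 0 every logarithm is
   [ln 1 = 0]. *)
have [x /[!in_itv]/= /andP[x0 xr]] : exists2 x, x \in `]0, r[ &
    (\sum_j h j) r - (\sum_j h j) 0 = (\sum_j dh j x) * (r - 0).
  apply: MVT => // [x /[!in_itv]/= /andP[x0 xr]|].
    by apply: der; rewrite ltW//= (lt_trans xr).
  apply: derivable_within_continuous => x /[!in_itv]/= /andP[x0 xr].
  by have [] := der x; rewrite ?x0 ?(le_lt_trans xr).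
have x1 : x < 1 by exact: lt_trans r1.
rewrite !hE [X in _ - X]big1; last first.
  by move=> j _; rewrite mulr0 mul0r expr0n/= !addr0 ln1 mul0r.
rewrite !subr0 => ->.
(* Multiplied by [x], the derivative of the logarithm is 1 minus the Poisson kernel, and the
   constant 1 sums to zero against the weights [w]. *)
have -> : \sum_j dh j x =
    - (n.+1%:R * (-1) ^+ k * (alias_weight n x k / (1 + x ^+ (2 * n.+1)))) / x.
  rewrite [_ * (_ / _)]mulrA -(sum_poisson_cheb_angle x0 x1 kn).
  rewrite -[LHS](mulfK (lt0r_neq0 x0)); congr (_ / _).
  apply/eqP; rewrite -subr_eq0 opprK mulr_suml -big_split/=; apply/eqP.
  transitivity (\sum_(j < n.+1) w j); last by apply: sum_cos_cheb_angle; lia.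
  apply: eq_bigr => j _; rewrite /dh -/(c j) -/(w j) /GRing.scale/=.
  have D0 : 0 < 1 + 2 * x * c j + x ^+ 2.
    by apply: poisson_denominator_gt0; rewrite ?cos_geN1 ?x1 ?ltW.
  by field; rewrite gt_eqF.
move: (alias_weight_bound x0 x1 kn'); move: (alias_weight n x k / _) => y y_le.
rewrite !normrM normrN !normrM normrX normrN1 expr1n mulr1 normfV.
rewrite (gtr0_norm r0) (gtr0_norm x0) ger0_norm// -mulrA -mulrA ler_wpM2l//.
apply: (@le_trans _ _ (x ^+ k * (x^-1 * r))).
  by rewrite ler_wpM2r// mulr_ge0 ?invr_ge0 ?ltW.
(* As [k] is positive, [x ^+ k / x] is a genuine power of exponent k - 1, hence at most the same
   power of [r]. *)
case: k k0 {kn kn' w h dh hE der y_le} => // k _.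
rewrite mulrA exprSr mulfK ?gt_eqF// exprSr ler_wpM2r ?(ltW r0)//.
by rewrite lerXn2r// ?nnegrE ltW.
Qed.

(** * Lipschitz bounds for Chebyshev polynomials and a power series *)

Lemma norm_sin_nat (R : realType) k (t : R) : `|sin (k%:R * t)| <= k%:R * `|sin t|.
Proof.
elim: k => [|k IH]; first by rewrite !mul0r sin0 normr0.
rewrite -natr1 !mulrDl !mul1r sinD (le_trans (ler_normD _ _))// !normrM.
have c1 (x : R) : `|cos x| <= 1 by rewrite ler_norml cos_geN1 cos_le1.
rewrite lerD ?ler_piMl//.
by rewrite (le_trans _ IH)// ler_piMr.
Qed.

(** A difference of cosines is a product of two sines, and each sine contributes one factor [k]. *)
Lemma norm_cos_natB (R : realType) k (t u : R) :
  `|cos (k%:R * t) - cos (k%:R * u)| <= k%:R ^+ 2 * `|cos t - cos u|.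
Proof.
have E (x y : R) : cos x - cos y = - 2 * (sin ((x + y) / 2) * sin ((x - y) / 2)).
  rewrite [in LHS](_ : x = (x + y) / 2 + (x - y) / 2); last by field.
  rewrite [X in _ - cos X](_ : y = (x + y) / 2 - (x - y) / 2); last by field.
  by rewrite cosB cosD; ring.
rewrite !E -mulrDr -mulrBr -!(mulrA k%:R) !normrM.
set a := (t + u) / 2; set b := (t - u) / 2; set c := `|_ 2|.
have -> : k%:R * (k%:R * (c * (`|sin a| * `|sin b|))) =
  c * ((k%:R * `|sin a|) * (k%:R * `|sin b|)) by ring.
apply: ler_wpM2l; first exact: normr_ge0.
by apply: ler_pM => //; exact: norm_sin_nat.
Qed.

Lemma chebyshev_lipschitz (R : realType) k (x y : R) : `|x| <= 1 -> `|y| <= 1 ->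
  `|(Defs.chebyshev k).[x] - (Defs.chebyshev k).[y]| <= k%:R ^+ 2 * `|x - y|.
Proof.
rewrite (ler_norml x) (ler_norml y) => x1 y1.
have [[_ <-] [_ <-]] := (acos_def x1, acos_def y1).
by rewrite !chebyshev_cos norm_cos_natB.
Qed.

Lemma sum_sqr_geometric (R : realType) K (q : R) : 0 <= q < 1 ->
  \sum_(k < K) k%:R ^+ 2 * q ^+ k <= q * (1 + q) / (1 - q) ^+ 3.
Proof.
move=> /andP[q0 q1]; have q1' : 0 < 1 - q by rewrite subr_gt0.
rewrite ler_pdivlMr ?exprn_gt0//.
(* The bound is the value of the infinite series; the remainder has a closed form, visibly
   nonnegative. *)
have -> : (\sum_(k < K) k%:R ^+ 2 * q ^+ k) * (1 - q) ^+ 3 =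
  q * (1 + q) - q ^+ K * (K%:R ^+ 2 * (1 - q) ^+ 2 + 2 * K%:R * q * (1 - q) +
                          q * (1 + q)).
  elim: K => [|K IH]; first by rewrite big_ord0 expr0; ring.
  by rewrite big_ord_recr/= mulrDl IH (exprS q K) -(natr1 K); ring.
have q2 := ltW q1'.
rewrite gerBl; apply: mulr_ge0; first exact: exprn_ge0.
apply: addr_ge0; last by rewrite mulr_ge0// addr_ge0.
by apply: addr_ge0; rewrite !mulr_ge0// exprn_ge0.
Qed.

(** * The Lipschitz constant of the interpolant of the logarithm *)

Section LogInterpolant.
Context {R : realType} (delta : R).
Hypotheses (delta_gt0 : 0 < delta) (delta_lt : delta < 1 / 2).

(* [r + r^-1 = 2 / (1 - 2 * delta)]: the logarithm pulled back to [-1, 1] is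
   analytic inside the Bernstein ellipse of parameter [r^-1]. *)
Definition log_radius : R :=
  (Num.sqrt (delta^-1 - 1) - 1) / (Num.sqrt (delta^-1 - 1) + 1).

Let s := Num.sqrt (delta^-1 - 1).

Let delta_inv_gt2 : 2 < delta^-1.
Proof. by rewrite -[2]invrK ltf_pV2 ?posrE ?invr_gt0// -div1r. Qed.

Let s_gt1 : 1 < s.
Proof.
by rewrite /s -[ltLHS]sqrtr1 ltr_sqrt; move: delta_inv_gt2; lra.
Qed.

Lemma log_radius_gt0_lt1 : 0 < log_radius < 1.
Proof.
rewrite /log_radius -/s divr_gt0 ?subr_gt0 ?addr_gt0 ?(lt_trans ltr01 s_gt1)//=.
by rewrite ltr_pdivrMr; move: s_gt1; lra.
Qed.

(** The logarithm of the right-hand side is a constant plus the logarithm bounded through the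
    Poisson kernel. *)
Lemma log_radiusE x : (1 - 2 * delta) / 2 * x + 1 / 2 =
  delta * (s + 1) ^+ 2 / 4 * (1 + 2 * log_radius * x + log_radius ^+ 2).
Proof.
have s2 : s ^+ 2 = delta^-1 - 1.
  by rewrite sqr_sqrtr//; move: delta_inv_gt2; lra.
have s1 : s + 1 != 0 by rewrite gt_eqF//; move: s_gt1; lra.
have d0 : delta != 0 by rewrite gt_eqF.
rewrite /log_radius -/s.
transitivity (delta / 2 * ((s ^+ 2 + 1) + (s ^+ 2 - 1) * x)).
  by rewrite s2; field.
by field.
Qed.

(** The additive constant drops out since T_k sums to zero over the nodes for 0 < k <= n. *)
Lemma cheb_coef_bound n k : (0 < k <= n)%N ->
  `|cheb_coef delta n k| <= 2 * log_radius ^+ k.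
Proof.
move=> kn; have /andP[k0 kn'] := kn.
have /andP[r0 r1] := log_radius_gt0_lt1.
have kap : 0 < delta * (s + 1) ^+ 2 / 4.
  by rewrite divr_gt0// mulr_gt0// exprn_gt0//; move: s_gt1; lra.
rewrite /cheb_coef gtn_eqF// subr0.
under eq_bigr => j _.
  rewrite /cheb_node -/(cheb_angle R n j) chebyshev_cos log_radiusE lnM ?posrE//;
    last by apply: poisson_denominator_gt0; rewrite ?cos_geN1 ?r1 ?ltW.
  rewrite mulrDl; over.
rewrite big_split/= -mulr_sumr sum_cos_cheb_angle; last lia.
rewrite mulr0 add0r normrM ger0_norm ?divr_ge0// -mulrA ler_wpM2l//.
rewrite ler_pdivrMl ?ltr0n//; apply: sum_log_cheb_angle_bound => //.
exact: log_radius_gt0_lt1.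
Qed.

(** Term [k] contributes 2 q^k from its coefficient, k^2 from T_k and the slope 2 / (1 - 2 delta) of
    the change of variable. The ratio [q] is left free so that it can later be the inverse of
    [rho]. *)
Lemma cheb_log_lipschitz n (q x y : R) : log_radius <= q < 1 ->
  delta <= x <= 1 - delta -> delta <= y <= 1 - delta ->
  `|(cheb_log delta n).[x] - (cheb_log delta n).[y]| <=
    4 / (1 - 2 * delta) * (q * (1 + q) / (1 - q) ^+ 3) * `|x - y|.
Proof.
move=> /andP[rq q1] xI yI; have /andP[r0 r1] := log_radius_gt0_lt1.
have q0 : 0 <= q by rewrite ltW// (lt_le_trans r0).
have e0 : 0 < 1 - 2 * delta by move: delta_lt; lra.
pose u (z : R) := 2 / (1 - 2 * delta) * z - 1 / (1 - 2 * delta).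
have u1 z : delta <= z <= 1 - delta -> `|u z| <= 1.
  move=> zI; have -> : u z = (2 * z - 1) / (1 - 2 * delta).
    by rewrite /u; field; rewrite gt_eqF.
  rewrite normrM normfV (gtr0_norm e0) ler_pdivrMr// mul1r ler_norml; lra.
have pE z : (cheb_log delta n).[z] =
    \sum_(k < n.+1) cheb_coef delta n k * (Defs.chebyshev k).[u z].
  rewrite horner_sum; apply: eq_bigr => k _.
  by rewrite hornerZ horner_comp hornerD hornerN hornerZ hornerX hornerC.
rewrite !pE -sumrB.
have uB : `|u x - u y| = 2 / (1 - 2 * delta) * `|x - y|.
  have -> : u x - u y = 2 / (1 - 2 * delta) * (x - y) by rewrite /u; ring.
  by rewrite normrM gtr0_norm// divr_gt0.
apply: (@le_trans _ _ (\sum_(k < n.+1) 4 / (1 - 2 * delta) * `|x - y| *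
     (k%:R ^+ 2 * q ^+ k))); last first.
  rewrite -mulr_sumr [leRHS]mulrAC; apply: ler_wpM2l.
    by rewrite mulr_ge0// divr_ge0// ltW.
  by apply: sum_sqr_geometric; rewrite q0.
rewrite (le_trans (ler_norm_sum _ _ _))//; apply: ler_sum => k _.
rewrite -mulrBr normrM.
(* The coefficient bound excludes k = 0, but that term is constant and cancels. *)
have [k0|k0] := posnP k.
  by rewrite k0 !hornerC subrr normr0 mulr0 expr0n/= mul0r mulr0.
have B : `|cheb_coef delta n k| <= 2 * q ^+ k.
  apply: (le_trans (cheb_coef_bound _)); first by rewrite k0 -ltnS ltn_ord.
  by rewrite ler_wpM2l// lerXn2r// nnegrE ltW.
have T := chebyshev_lipschitz k (u1 _ xI) (u1 _ yI).
apply: (le_trans (ler_pM _ _ B T)) => //.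
by rewrite uB le_eqVlt; apply/orP; left; apply/eqP; ring.
Qed.

End LogInterpolant.

(** * From scalar to Frobenius Lipschitz bounds *)

Section FrobeniusLipschitz.
Local Open Scope sesquilinear_scope.
Context {R : realType} {d : nat}.
Local Notation C := R[i]%C.
Local Notation toC := (real_complex R).
Implicit Types (A B : 'M[R]_d.+1) (p : {poly R}).

(** The spectral theorem is applied to the complexified matrix. Only the eigenbasis stays complex:
    the eigenvalues are real and descend to eigenvalues of [A]. *)
Lemma symmetric_unitary_diag A : A^T = A ->
  exists U : 'M[C]_d.+1, exists l : 'rV[R]_d.+1,
  [/\ U \is unitarymx, forall i, eigenvalue A (l 0 i) &
      map_mx toC A = invmx U *m diag_mx (map_mx toC l) *m U].
Proof.
move=> A_sym; set AC := map_mx toC A.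
have AC_real : AC \is a realmx.
  by apply/mxOverP => i j; rewrite mxE; apply/complex_realP; exists (A i j).
have AC_herm : AC \is hermsymmx.
  apply: realsym_hermsym => //; apply/is_hermitianmxP.
  by rewrite expr0 scale1r map_mx_id// /AC map_trmx A_sym.
pose U := spectralmx AC; pose D := spectral_diag AC.
have U_unit : U \in unitmx by exact: spectral_unit.
have ACE : AC = invmx U *m diag_mx D *m U.
  by apply/orthomx_spectralP/hermitian_normalmx.
have D_real i : toC (complex.Re (D 0 i)) = D 0 i.
  by apply: RRe_real; apply: (mxOverP (hermitian_spectral_diag_real AC_herm)).
have DE : D = map_mx toC (map_mx (@complex.Re R) D).
  by apply/rowP => i; rewrite !mxE D_real.
exists U, (map_mx (@complex.Re R) D); split.
- exact: spectral_unitarymx.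
- move=> i; rewrite -(eigenvalue_map toC) [map_mx _ D 0 i]mxE /= D_real.
  (* Row [i] of [U] is a left eigenvector, nonzero because [U] is invertible. *)
  apply/eigenvalueP; exists (row i U).
    rewrite -/AC ACE -row_mul -!mulmxA mulKVmx// mul_diag_mx.
    by apply/rowP => j; rewrite !mxE.
  apply/eqP => Ui; have := mulmxV U_unit; move=> /(congr1 (row i)).
  rewrite row_mul Ui mul0mx => /rowP/(_ i); rewrite !mxE eqxx => /eqP.
  by rewrite eq_sym oner_eq0.
- by rewrite -DE.
Qed.

(** The squared Frobenius norm over the complex numbers; its form as a trace makes it unitarily
    invariant. *)
Definition hs_norm2 (M : 'M[C]_d.+1) : C := \sum_i \sum_j `|M i j| ^+ 2.

Lemma hs_norm2E (M : 'M[C]_d.+1) : hs_norm2 M = \tr (M *m M^t*).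
Proof.
apply: eq_bigr => i _; rewrite mxE; apply: eq_bigr => j _.
by rewrite !mxE normCK.
Qed.

Lemma hs_norm2_unitary (U W M : 'M[C]_d.+1) :
  U \is unitarymx -> W \is unitarymx -> hs_norm2 (U *m M *m invmx W) = hs_norm2 M.
Proof.
move=> Uu Wu; rewrite !hs_norm2E invmx_unitary//.
rewrite !trmx_mul !map_mxM trmxCK !mulmxA.
rewrite mulmxKtV//.
rewrite mxtrace_mulC !mulmxA -(invmx_unitary Uu) mulVmx ?unitarymx_unit//.
by rewrite mul1mx.
Qed.

Lemma hs_norm2_real A : hs_norm2 (map_mx toC A) = toC (frobenius A ^+ 2).
Proof.
rewrite /frobenius sqr_sqrtr; last first.
  by apply: sumr_ge0 => i _; apply: sumr_ge0 => j _; exact: sqr_ge0.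
rewrite rmorph_sum; apply: eq_bigr => i _; rewrite rmorph_sum.
apply: eq_bigr => j _; rewrite mxE normCK rmorphXn expr2.
by congr (_ * _); exact: conjc_real.
Qed.

Lemma map_horner_mx_diag A p (U : 'M[C]_d.+1) (l : 'rV[R]_d.+1) :
  U \in unitmx -> map_mx toC A = invmx U *m diag_mx (map_mx toC l) *m U ->
  map_mx toC (horner_mx A p) =
  invmx U *m diag_mx (map_mx toC (map_mx (horner p) l)) *m U.
Proof.
move=> Uu AE; rewrite map_horner_mx AE horner_mx_uconjC//.
rewrite horner_mx_diag; congr (_ *m diag_mx _ *m _).
by apply/rowP => i; rewrite !mxE horner_map.
Qed.

Lemma frobenius_horner_lipschitz A B p (a b L : R) : 0 <= L ->
  A^T = A -> B^T = B -> spectrum_in A a b -> spectrum_in B a b ->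
  (forall x y, a <= x <= b -> a <= y <= b -> `|p.[x] - p.[y]| <= L * `|x - y|) ->
  frobenius (horner_mx A p - horner_mx B p) ^+ 2 <= L ^+ 2 * frobenius (A - B) ^+ 2.
Proof.
move=> L0 A_sym B_sym A_spec B_spec p_lip.
have [U [l [Uu l_eig AE]]] := symmetric_unitary_diag A_sym.
have [W [m [Wu m_eig BE]]] := symmetric_unitary_diag B_sym.
have UU := unitarymx_unit Uu; have WU := unitarymx_unit Wu.
(* The entries of [U p(A) W^* - U p(B) W^*] are [(p l_i - p m_j) (U W^* )_ij]. *)
have key q : toC (frobenius (horner_mx A q - horner_mx B q) ^+ 2) =
    \sum_i \sum_j toC ((q.[l 0 i] - q.[m 0 j]) ^+ 2) * `|(U *m invmx W) i j| ^+ 2.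
  rewrite -hs_norm2_real -(hs_norm2_unitary _ Uu Wu) map_mxB.
  rewrite (map_horner_mx_diag q UU AE) (map_horner_mx_diag q WU BE).
  rewrite mulmxBr mulmxBl !mulmxA mulmxV// mul1mx -[X in _ - X]mulmxA mulmxV//.
  rewrite mulmx1 -mulmxA mul_diag_mx mul_mx_diag.
  apply: eq_bigr => i _; apply: eq_bigr => j _; rewrite !mxE.
  rewrite [X in _ - X]mulrC -mulrBl normrM exprMn -rmorphB; congr (_ * _).
  by rewrite normCK rmorphXn expr2; congr (_ * _); exact: conjc_real.
(* For [q = 'X] the same identity describes [A - B] with the same nonnegative weights, so the two
   sums can be compared term by term. *)
have := key 'X; rewrite !horner_mx_X => keyX.
have toCM x y : toC (x * y) = toC x * toC y by exact: rmorphM.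
rewrite -lecR (toCM (L ^+ 2)) key keyX mulr_sumr; apply: ler_sum => i _.
rewrite mulr_sumr; apply: ler_sum => j _.
rewrite mulrA ler_wpM2r ?exprn_ge0// -toCM lecR !hornerX.
rewrite -[leLHS]real_normK ?num_real// -[X in _ * X]real_normK ?num_real//.
rewrite -exprMn lerXn2r ?nnegrE ?mulr_ge0// p_lip//.
  exact: A_spec.
exact: B_spec.
Qed.

End FrobeniusLipschitz.

(** * Averages over uniform sign patterns *)

Section SignPatterns.
Context {R : realType} {K : finType}.
Implicit Types (e : {ffun K -> bool}) (F G : {ffun K -> bool} -> R).

Definition sign_mean F : R := 2^-1 ^+ #|K| * \sum_e F e.

Lemma sign_mean_cst (c : R) : sign_mean (fun=> c) = c.
Proof.
rewrite /sign_mean sumr_const card_ffun card_bool -[c *+ _]mulr_natl natrX.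
by rewrite mulrA -exprMn mulVf ?pnatr_eq0// expr1n mul1r.
Qed.

Lemma sign_meanD F G : sign_mean (fun e => F e + G e) = sign_mean F + sign_mean G.
Proof. by rewrite /sign_mean big_split mulrDr. Qed.

Lemma sign_meanZ c F : sign_mean (fun e => c * F e) = c * sign_mean F.
Proof. by rewrite /sign_mean -mulr_sumr mulrCA. Qed.

Lemma sign_mean_sum (I : finType) (Q : pred I) (H : I -> {ffun K -> bool} -> R) :
  sign_mean (fun e => \sum_(i | Q i) H i e) = \sum_(i | Q i) sign_mean (H i).
Proof. by rewrite /sign_mean exchange_big mulr_sumr. Qed.

Definition flip_sign (a : K) e : {ffun K -> bool} := [ffun k => e k (+) (k == a)].

Lemma flip_signK a : involutive (flip_sign a).
Proof. by move=> e; apply/ffunP => k; rewrite !ffunE -addbA addbb addbF. Qed.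

(** Flipping one sign permutes the patterns, so the sum equals its own opposite. *)
Lemma sign_mean_odd a F : (forall e, F (flip_sign a e) = - F e) -> sign_mean F = 0.
Proof.
move=> F_odd; suff E : \sum_e F e = - \sum_e F e.
  by rewrite /sign_mean (_ : \sum_e F e = 0) ?mulr0//; lra.
rewrite -sumrN (reindex_inj (inv_inj (flip_signK a)))/=.
by apply: eq_bigr.
Qed.

(** [true] encodes the sign -1, so exclusive or becomes multiplication. *)
Definition sgn e k : R := (-1) ^+ e k.

Lemma sgn_flip e a k : sgn (flip_sign a e) k = if k == a then - sgn e k else sgn e k.
Proof.
by rewrite /sgn ffunE signr_addb; case: eqP => _; rewrite ?expr1 ?mulrN1 ?mulr1.
Qed.

Lemma sgn_sqr e k : sgn e k * sgn e k = 1.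
Proof. by rewrite /sgn -signr_addb addbb. Qed.

Lemma sign_mean_sgn2 a b : a != b -> sign_mean (fun e => sgn e a * sgn e b) = 0.
Proof.
move=> ab; apply: (@sign_mean_odd a) => e; rewrite !sgn_flip eqxx.
by rewrite eq_sym (negbTE ab) mulNr.
Qed.

(** The sign at [a] occurs exactly once, so the product is odd under flipping it; the other three
    indices may coincide. *)
Lemma sign_mean_sgn4 a b c d' : a != b -> a != c -> a != d' ->
  sign_mean (fun e => sgn e a * sgn e b * (sgn e c * sgn e d')) = 0.
Proof.
move=> ab ac ad; apply: (@sign_mean_odd a) => e; rewrite !sgn_flip eqxx.
by rewrite ![_ == a]eq_sym (negbTE ab) (negbTE ac) (negbTE ad) !mulNr.
Qed.

End SignPatterns.

(** * Variance of the Hutchinson estimator *)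

Lemma sum_diag_upper (R : nmodType) n (g : 'I_n -> 'I_n -> R) :
  \sum_i \sum_j g i j =
  \sum_i g i i + \sum_(p : 'I_n * 'I_n | (p.1 < p.2)%N) (g p.1 p.2 + g p.2 p.1).
Proof.
rewrite pair_big/= (bigID (fun p => p.1 == p.2))/=; congr (_ + _).
  rewrite (reindex_onto (fun i => (i, i)) fst)/=; last by move=> [i j] /= /eqP ->.
  by apply: eq_bigl => i; rewrite !eqxx.
rewrite (bigID (fun p : 'I_n * 'I_n => (p.1 < p.2)%N))/= big_split/=; congr (_ + _).
  by apply: eq_bigl => -[i j] /=; rewrite -(inj_eq val_inj)/=; case: ltngtP.
pose sw (p : 'I_n * 'I_n) := (p.2, p.1).
have swK : involutive sw by case.
rewrite (reindex_inj (inv_inj swK))/=.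
by apply: eq_bigl => -[i j] /=; rewrite -(inj_eq val_inj)/=; case: ltngtP.
Qed.

Section Hutchinson.
Context {R : realType} {m d : nat} (C : 'M[R]_d).
Local Notation K := ('I_m * 'I_d)%type.

(** One pattern carries the signs of all [m] vectors: index [(t, i)] is entry [i] of vector [t]. *)
Definition hutchinson (e : {ffun K -> bool}) : R :=
  m%:R^-1 * \sum_(t < m) \sum_i \sum_j C i j * (sgn e (t, i) * sgn e (t, j)).

Let Q (k : 'I_m * ('I_d * 'I_d)) := (k.2.1 < k.2.2)%N.
Let a (k : 'I_m * ('I_d * 'I_d)) : R := m%:R^-1 * (C k.2.1 k.2.2 + C k.2.2 k.2.1).
Let chi (k : 'I_m * ('I_d * 'I_d)) e : R := sgn e (k.1, k.2.1) * sgn e (k.1, k.2.2).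

(** Squares of signs are 1, so the diagonal gives the deterministic trace and all randomness sits in
    the products with i < j. *)
Lemma hutchinsonE e : (0 < m)%N ->
  hutchinson e = \tr C + \sum_(k | Q k) a k * chi k e.
Proof.
move=> m0; rewrite /hutchinson.
under eq_bigr => t _.
  rewrite sum_diag_upper; under eq_bigr do rewrite sgn_sqr mulr1.
  under [X in _ + X]eq_bigr do rewrite [sgn e (t, _.2) * _]mulrC -mulrDl.
  over.
rewrite big_split/= mulrDr sumr_const card_ord -(mulr_natl (\sum_i C i i)) mulrA mulVf.
  rewrite mul1r; congr (_ + _); rewrite pair_big_dep/= mulr_sumr.
  apply: eq_big => [[t [i j]]|[t [i j]] _]; first by [].
  by rewrite /a /chi -!mulrA.
by rewrite pnatr_eq0 -lt0n.
Qed.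

Lemma chi_orthonormal k l : Q k -> Q l ->
  sign_mean (fun e => chi k e * chi l e) = (k == l)%:R.
Proof.
move: k l => [t [i j]] [u [i' j']]; rewrite /Q /chi /= => ij ij'.
have [E|kl] := eqVneq (t, (i, j)) (u, (i', j')).
  rewrite -[RHS](@sign_mean_cst R K); congr sign_mean; apply/funext => e.
  by case: E => <- <- <-; rewrite mulrACA !sgn_sqr mulr1.
have nij : (t, i) != (t, j) by apply/eqP => -[E]; rewrite E ltnn in ij.
have [ab|] := boolP (((t, i) != (u, i')) && ((t, i) != (u, j'))).
  by move/andP: ab => [? ?]; exact: sign_mean_sgn4.
have [ab _|] := boolP (((t, j) != (u, i')) && ((t, j) != (u, j'))).
  move/andP: ab => [? ?].
  under [X in sign_mean X]funext do rewrite [sgn _ (t, i) * _]mulrC.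
  by apply: sign_mean_sgn4 => //; rewrite eq_sym.
(* Otherwise both indices of the first pair occur in the second, and the orderings i < j, i' < j'
   force equality of the pairs. *)
move=> h1 h2; exfalso; move: kl h1 h2 ij ij'.
rewrite !xpair_eqE -!(inj_eq val_inj)/=; lia.
Qed.

Lemma sign_mean_chi k : Q k -> sign_mean (chi k) = 0.
Proof.
move: k => [t [i j]]; rewrite /Q /chi /= => ij; apply: sign_mean_sgn2.
by apply/eqP => -[E]; rewrite E ltnn in ij.
Qed.

(** By orthonormality the variance is the sum of the squared coefficients [a k]; (x + y)^2 <= 2 (x^2
    + y^2) then compares it with the off-diagonal part of the Frobenius norm. *)
Lemma hutchinson_variance : (0 < m)%N ->
  sign_mean (fun e => (hutchinson e - sign_mean hutchinson) ^+ 2) <=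
    2 / m%:R * frobenius C ^+ 2.
Proof.
move=> m0.
have -> : sign_mean hutchinson = \tr C.
  have -> : hutchinson = fun e => \tr C + \sum_(k | Q k) a k * chi k e.
    by apply/funext => e; rewrite hutchinsonE.
  rewrite sign_meanD sign_mean_cst sign_mean_sum big1 ?addr0// => k Qk.
  by rewrite sign_meanZ sign_mean_chi// mulr0.
have -> : (fun e => (hutchinson e - \tr C) ^+ 2) = fun e =>
    \sum_(k | Q k) \sum_(l | Q l) (a k * a l) * (chi k e * chi l e).
  apply/funext => e; rewrite hutchinsonE// addrC addKr expr2 mulr_suml.
  apply: eq_bigr => k _; rewrite mulr_sumr; apply: eq_bigr => l _.
  by rewrite mulrACA.
rewrite sign_mean_sum.
have -> : \sum_(k | Q k) sign_mean
     (fun e => \sum_(l | Q l) (a k * a l) * (chi k e * chi l e)) =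
    \sum_(k | Q k) a k ^+ 2.
  apply: eq_bigr => k Qk; rewrite sign_mean_sum (bigD1 k)//= big1 ?addr0.
    by rewrite sign_meanZ chi_orthonormal// eqxx mulr1.
  move=> l /andP[Ql lk].
  by rewrite sign_meanZ chi_orthonormal// eq_sym (negbTE lk) mulr0.
rewrite /frobenius sqr_sqrtr; last first.
  by apply: sumr_ge0 => i _; apply: sumr_ge0 => j _; exact: sqr_ge0.
have -> : \sum_(k | Q k) a k ^+ 2 = m%:R^-1 *
    \sum_(p : 'I_d * 'I_d | (p.1 < p.2)%N) (C p.1 p.2 + C p.2 p.1) ^+ 2.
  transitivity (\sum_(t < m) \sum_(p : 'I_d * 'I_d | (p.1 < p.2)%N)
       (m%:R^-1 ^+ 2 * (C p.1 p.2 + C p.2 p.1) ^+ 2)).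
    rewrite pair_big_dep/=; apply: eq_bigr => k _; exact: exprMn.
  rewrite sumr_const card_ord -mulr_sumr -[LHS]mulr_natl.
  by field; rewrite pnatr_eq0 -lt0n.
rewrite [leRHS]mulrAC [leRHS]mulrC ler_wpM2l ?invr_ge0//.
rewrite sum_diag_upper mulrDr.
(* The 0 is a lower bound for the diagonal contribution. *)
apply: (@le_trans _ _ (0 + \sum_(p : 'I_d * 'I_d | (p.1 < p.2)%N)
    2 * (C p.1 p.2 ^+ 2 + C p.2 p.1 ^+ 2))).
  rewrite add0r; apply: ler_sum => p _; rewrite -subr_ge0.
  have -> : 2 * (C p.1 p.2 ^+ 2 + C p.2 p.1 ^+ 2) - (C p.1 p.2 + C p.2 p.1) ^+ 2 =
    (C p.1 p.2 - C p.2 p.1) ^+ 2 by ring.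
  exact: sqr_ge0.
rewrite -mulr_sumr lerD2r.
by apply: mulr_ge0 => //; apply: sumr_ge0 => i _; exact: sqr_ge0.
Qed.

End Hutchinson.

(** * The law of the random sign pattern *)

Section RademacherLaw.
Context {R : realType} {dT : measure_display} {T : measurableType dT}.
Context (P : probability T R) {d m : nat} (v : 'I_m -> {RV P >-> d.-tuple R}).
Hypothesis v_rad : forall t, rademacher_vector P (v t).
Hypothesis v_indep : mutually_independent P (fun t => v t : T -> d.-tuple R).
Local Notation K := ('I_m * 'I_d)%type.

Definition sign_pattern (w : T) : {ffun K -> bool} :=
  [ffun k => tnth (v k.1 w) k.2 == -1].

Lemma sgn_sign_pattern w t i : sgn (sign_pattern w) (t, i) = tnth (v t w) i.
Proof.
rewrite /sgn ffunE/=; have [v1 _ _ _] := v_rad t.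
have [->|->] := v1 w i; last by rewrite eqxx expr1.
by rewrite -subr_eq0 opprK (_ : 1 + 1 = 2)// pnatr_eq0.
Qed.

Let box (e : {ffun K -> bool}) t : set (d.-tuple R) :=
  \bigcap_(i in [set: 'I_d]) ((fun x : d.-tuple R => tnth x i) @^-1` [set sgn e (t, i)]).

Let measurable_box e t : measurable (box e t).
Proof.
apply: fin_bigcap_measurable => //= i _.
by rewrite -[X in measurable X]setTI; exact: measurable_tnth.
Qed.

Let sign_pattern_box e : sign_pattern @^-1` [set e] =
  \bigcap_(t in [set` [set: 'I_m]%SET]) (v t @^-1` box e t).
Proof.
apply/seteqP; split=> [w /= <- t _ i _ /=|w /= h].
  by rewrite sgn_sign_pattern.
apply/ffunP => -[t i]; have := h t (finset.in_setT t) i I => /=.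
rewrite -sgn_sign_pattern /sgn => /eqP.
by case: (sign_pattern w _); case: (e _) => //=; rewrite ?expr0 ?expr1 => /eqP; lra.
Qed.

Lemma measurable_sign_pattern e : measurable (sign_pattern @^-1` [set e]).
Proof.
rewrite sign_pattern_box; apply: fin_bigcap_measurable; first exact: finite_finset.
move=> t _; rewrite -[X in measurable X]setTI.
exact: (measurable_funPT (v t)).
Qed.

(** Independence is used twice: across the vectors, then across the entries of each vector. *)
Lemma sign_pattern_uniform e :
  P (sign_pattern @^-1` [set e]) = (2^-1 ^+ #|{: K}|)%:E.
Proof.
rewrite sign_pattern_box v_indep//.
have E t : P (v t @^-1` box e t) = (2^-1 ^+ d)%:E.
  have [_ P1 PN1 ind] := v_rad t.
  have -> : v t @^-1` box e t = \bigcap_(i in [set` [set: 'I_d]%SET])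
      ((fun w => tnth (v t w) i) @^-1` [set sgn e (t, i)]).
    apply/seteqP; split=> [w h i _|w h i _]; first exact: h.
    exact: (h i (finset.in_setT i)).
  rewrite ind//.
  under eq_bigr => i _.
    have -> : P ((fun w => tnth (v t w) i) @^-1` [set sgn e (t, i)]) = (2^-1)%:E.
      rewrite -div1r /sgn; case: (e _); [exact: PN1|exact: P1].
    over.
  by rewrite prodEFin prodr_const cardsT card_ord.
under eq_bigr do rewrite E.
by rewrite prodEFin prodr_const cardsT card_ord card_prod !card_ord -exprM mulnC.
Qed.

(** The composite is a finite linear combination of indicators of the events fixing the pattern. *)
Lemma expectation_sign_pattern (F : {ffun K -> bool} -> R) :
  ('E_P[F \o sign_pattern] = (sign_mean F)%:E)%E.
Proof.
rewrite unlock.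
have E w : (((F \o sign_pattern) w)%:E =
    \sum_(e : {ffun K -> bool}) (F e)%:E * (\1_(sign_pattern @^-1` [set e]) w)%:E)%E.
  rewrite (bigD1 (sign_pattern w))//= big1 ?adde0.
    by rewrite indicE mem_set// mule1.
  move=> e ne; rewrite indicE memNset ?mule0//= => h.
  by rewrite h eqxx in ne.
under eq_integral do rewrite E.
have int e : P.-integrable setT (fun w => (\1_(sign_pattern @^-1` [set e]) w)%:E).
  by apply: integrable_indic; exact: measurable_sign_pattern.
rewrite integral_sum//; last by move=> e; exact: integrableZl.
have intE e : (\int[P]_w ((F e)%:E * (\1_(sign_pattern @^-1` [set e]) w)%:E) =
    (F e * 2^-1 ^+ #|{: K}|)%:E)%E.
  rewrite integralZl// integral_indic//; last exact: measurable_sign_pattern.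
  by rewrite setIT EFinM -(sign_pattern_uniform e).
under eq_bigr do rewrite intE.
rewrite /sign_mean mulr_sumr sumEFin; congr EFin; apply: eq_bigr => e _.
exact: mulrC.
Qed.

Lemma variance_sign_pattern (F : {ffun K -> bool} -> R) :
  ('V_P[F \o sign_pattern] =
     (sign_mean (fun e => (F e - sign_mean F) ^+ 2))%:E)%E.
Proof.
rewrite /variance unlock expectation_sign_pattern/=.
rewrite -expectation_sign_pattern; congr expectation.
Qed.

End RademacherLaw.

(** * Variance of the difference of the two estimators *)

(** Because both estimators share their vectors, the difference is a single Hutchinson estimator for
    p(A) - p(B). *)
Lemma ldas_diff_hutchinson (R : realType) (dT : measure_display)
    (T : measurableType dT) (P : probability T R) (delta : R) (d n m : nat)
    (A B : 'M[R]_d.+1) (v : 'I_m -> {RV P >-> d.+1.-tuple R}) :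
  (forall t, rademacher_vector P (v t)) ->
  ldas delta n v A \- ldas delta n v B =
  hutchinson (horner_mx A (cheb_log delta n) - horner_mx B (cheb_log delta n))
    \o sign_pattern v.
Proof.
move=> v_rad; apply/funext => w; rewrite /= /ldas /hutchinson -mulrBr -sumrB.
congr (_ * _); apply: eq_bigr => t _; move: (horner_mx A _) (horner_mx B _) => H G.
set x : 'cV[R]_d.+1 := \col_i _.
have quadE (S : 'M[R]_d.+1) :
    (x^T *m S *m x) 0 0 = \sum_i \sum_j S i j * (x i 0 * x j 0).
  rewrite mxE exchange_big/=; apply: eq_bigr => j _; rewrite mxE mulr_suml.
  by apply: eq_bigr => i _; rewrite mxE; ring.
rewrite !quadE -sumrB; apply: eq_bigr => i _; rewrite -sumrB.
apply: eq_bigr => j _; rewrite -mulrBl !sgn_sign_pattern//.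
by rewrite !mxE.
Qed.

Lemma log_two_div_ge (R : realType) (delta : R) : 0 < delta -> delta < 1 / 2 ->
  1 <= 5 * ln (2 / delta).
Proof.
move=> d0 d1.
(* The inequality ln (1 + x) <= x at x = delta / 2 - 1 gives ln (2 / delta) >= 1 - delta / 2 > 3 /
   4. *)
have : ln (1 + (delta / 2 - 1)) <= delta / 2 - 1 by apply: le_ln1Dx; lra.
have -> : 1 + (delta / 2 - 1) = (2 / delta)^-1 by rewrite invf_div; ring.
rewrite lnV ?posrE ?divr_gt0//; lra.
Qed.

Theorem theorem2 (R : realType) (dT : measure_display) (T : measurableType dT)
    (P : probability T R) (delta : R) (d n m : nat) (A B : 'M[R]_d.+1)
    (v : 'I_m -> {RV P >-> d.+1.-tuple R})
    (delta_gt0 : 0 < delta) (delta_lt : delta < 1 / 2) (m_gt0 : (0 < m)%N)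
    (A_sym : A^T = A) (A_pd : positive_definite A)
    (A_spec : spectrum_in A delta (1 - delta))
    (B_sym : B^T = B) (B_pd : positive_definite B)
    (B_spec : spectrum_in B delta (1 - delta))
    (v_rad : forall t, rademacher_vector P (v t))
    (v_indep : mutually_independent P (fun t => v t : T -> d.+1.-tuple R)) :
  let M := 5 * ln (2 / delta) in
  let rho := 1 + 2 / (Num.sqrt (2 / delta - 1) - 1) in
  ('V_P[(ldas delta n v A \- ldas delta n v B)%R] <=
     (32 * M ^+ 2 * rho ^+ 2 * (rho + 1) ^+ 2 /
        (m%:R * (rho - 1) ^+ 6 * (1 - 2 * delta) ^+ 2) *
      frobenius (A - B) ^+ 2)%:E)%E.
Proof.
cbv zeta; set M := 5 * ln _; set s := Num.sqrt _; set rho := 1 + 2 / (s - 1).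
set p := cheb_log delta n.
have dinv : 2 < delta^-1.
  by rewrite -[2]invrK ltf_pV2 ?posrE ?invr_gt0// -div1r.
have s_gt1 : 1 < s.
  by rewrite /s -[ltLHS]sqrtr1 ltr_sqrt; lra.
have rhoE : rho = (s + 1) / (s - 1) by rewrite /rho; field; lra.
have rho_gt1 : 1 < rho by rewrite rhoE ltr_pdivlMr; lra.
have rho0 : rho != 0 by lra.
have rho1 : rho - 1 != 0 by lra.
have e0 : 0 < 1 - 2 * delta by lra.
(* Both sides are values of the increasing map x -> (x - 1) / (x + 1), at the square roots of 1 /
   delta - 1 and of 2 / delta - 1. *)
have q_range : log_radius delta <= rho^-1 < 1.
  rewrite invf_lt1 ?rho_gt1 ?(lt_trans ltr01)// andbT rhoE invf_div /log_radius.
  have : Num.sqrt (delta^-1 - 1) <= s by apply: ler_wsqrtr; lra.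
  have : 0 <= Num.sqrt (delta^-1 - 1) by exact: sqrtr_ge0.
  move: (Num.sqrt (delta^-1 - 1)) => r r0 rs.
  rewrite ler_pdivrMr; last by lra.
  rewrite mulrAC ler_pdivlMr; last by lra.
  rewrite -subr_ge0.
  have -> : (s - 1) * (r + 1) - (r - 1) * (s + 1) = 2 * (s - r) by ring.
  by rewrite mulr_ge0// subr_ge0.
(* This is the Lipschitz constant of [cheb_log_lipschitz] at q = 1 / rho, with denominators
   cleared. *)
pose L : R := 4 / (1 - 2 * delta) * (rho * (rho + 1) / (rho - 1) ^+ 3).
have L0 : 0 <= L.
  by rewrite /L mulr_ge0// divr_ge0 ?mulr_ge0 ?exprn_ge0//; lra.
have p_lip x y : delta <= x <= 1 - delta -> delta <= y <= 1 - delta ->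
    `|p.[x] - p.[y]| <= L * `|x - y|.
  move=> xI yI; apply: le_trans (cheb_log_lipschitz _ _ _ q_range xI yI) _ => //.
  rewrite le_eqVlt; apply/orP; left; apply/eqP; congr (_ * _ * _).
  by field; rewrite rho1 rho0.
have F0 := frobenius_horner_lipschitz L0 A_sym B_sym A_spec B_spec p_lip.
rewrite ldas_diff_hutchinson// variance_sign_pattern// lee_fin.
apply: le_trans (hutchinson_variance _ m_gt0) _.
have m0 : 0 < m%:R :> R by rewrite ltr0n.
have M1 : 1 <= M ^+ 2 by rewrite exprn_ege1// /M log_two_div_ge.
apply: (@le_trans _ _ (2 / m%:R * (L ^+ 2 * frobenius (A - B) ^+ 2))).
  by rewrite ler_wpM2l// divr_ge0// ltW.
(* Since 2 * 4 ^ 2 = 32, the target is exactly [M ^+ 2 >= 1] times the bound already reached. *)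
have -> : 32 * M ^+ 2 * rho ^+ 2 * (rho + 1) ^+ 2 /
    (m%:R * (rho - 1) ^+ 6 * (1 - 2 * delta) ^+ 2) * frobenius (A - B) ^+ 2 =
  M ^+ 2 * (2 / m%:R * (L ^+ 2 * frobenius (A - B) ^+ 2)).
  by rewrite /L; field; rewrite rho1 !gt_eqF.
apply: ler_peMl => //; apply: mulr_ge0; first by rewrite divr_ge0// ltW.
by rewrite mulr_ge0// sqr_ge0.
Qed.
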